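(* There is an absolute constant $C>0$ such that for each $\epsilon\in(0,1)$ there is a finite set $\mathcal{A}$ of integers, of size at most $\exp\left(C\cdot\frac{1}{\epsilon}\log\frac{1}{\epsilon}\right)$, such that for almost all primes $p$, some $a\in\mathcal{A}$ has multiplicative order modulo $p$ exceeding $p^{1-\epsilon}$.
   Context: A statement holds for almost all primes $p$ if, as $x\to\infty$, the number of primes $p\le x$ for which it fails is $o(x/\log x)$. The multiplicative order of an integer $a$ modulo $p$ is considered only when $p\nmid a$. *)

(* Defs.v *)
From mathcomp Require Import all_boot all_order all_algebra all_fingroup finmap.
From mathcomp Require Import all_classical all_reals all_analysis.
Set Implicit Arguments.
Unset Strict Implicit.
Unset Printing Implicit Defensive.
Import Order.TTheory GRing.Theory Num.Theory.
Import numFieldNormedType.Exports.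
Local Open Scope ring_scope.

(* For p prime and p not dividing a, the class of a is a unit of 'F_p and this
   is its order in the group of units; the junk value is 0 when p divides a. *)
Definition multorder (p : nat) (a : int) : nat :=
  if insub (a%:~R : 'F_p) is Some u then #[u : {unit 'F_p}]%g else 0%N.

(* For x < 0, Num.truncn x = 0, and the count is 0 as it should be. *)
Definition exceptional_primes (R : realType) (P : nat -> Prop) (x : R) : nat :=
  count (fun p => prime p && ~~ `[< P p >]) (iota 0 (Num.truncn x).+1).

(* The Landau notation needs a bundled filter. *)
Canonical pinfty_filterType (R : numFieldType) := FilterType (pinfty_nbhs R) _.

Definition almost_all_primes (R : realType) (P : nat -> Prop) : Prop :=
  (fun x : R => (exceptional_primes P x)%:R : R) =o_ (pinfty_nbhs R)
    (fun x : R => x / ln x).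

(* Main.v *)
Require Import Defs.
From mathcomp Require Import all_boot all_order all_algebra all_fingroup finmap.
From mathcomp Require Import all_classical all_reals all_analysis.
From mathcomp Require Import cyclic zify lra ring.
Import Order.TTheory GRing.Theory Num.Theory.
Import numFieldNormedType.Exports.

(** Take r about 4 / eps and distinct primes b_0, ..., b_(r-1).  The set A
    consists of the products of the b_i ^ e_i with 0 <= e_i < K, where
    K = r ^ 2; it has at most K ^ r = exp (2 r ln r) elements.  Two facts make
    it work.

    For almost all p the b_i generate a large subgroup H of the units modulo p.
    If the products of the b_i ^ f_i with 0 <= f_i <= E are distinct modulo p,
    then #|H| >= (E + 1) ^ r ([distinct_products_le_order]).  If two of them
    agree modulo p, cancelling the common part of the exponents shows that p
    divides a nonzero difference of two coprime products of powers of the b_i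
    with exponents at most E.  There are at most (2 E + 1) ^ r such differences,
    each with O(E) prime factors, so O(E ^ (r+1)) primes are lost
    ([count_primes_le]).  With E the integer part of x ^ theta and
    theta (r + 1) < 1 this is a power of x smaller than x, hence o(x / ln x),
    while every remaining p <= x has #|H| > p ^ (theta r).

    For every such p some element of A generates nearly all of H.  Taking
    discrete logarithms x_i of the b_i, and N = p - 1, the index in H of the
    subgroup generated by a product is
    gcd (N, sum e_i x_i) / gcd (N, x_0, ..., x_(r-1)).  For two generators, the
    numbers m_e = gcd (N, x + e y) / gcd (N, x, y) with e < K all divide N, and
    any two of them have a gcd dividing the difference of their parameters,
    so at most K.  Hence their product is at most N times a constant, and the
    smallest is O(N ^ (1/K)) ([exists_small_gcd_on_line]).  Adding the
    generators one at a time bounds the index by O(N ^ (r/K))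
    ([exists_small_gcd_combination]), which is O(p ^ (1/r)).

    When eps > 1/2 the target bound forces A to be small, a singleton as eps
    tends to 1; there a single prime works, by the first fact with r = 1
    and theta = 1 - eps. *)

Local Open Scope nat_scope.

(** * Combinations with a small greatest common divisor *)

Lemma gcdnM_dvd a b m : gcdn (a * b) m %| gcdn a m * gcdn b m.
Proof.
rewrite muln_gcdl !muln_gcdr !dvdn_gcd dvdn_gcdl.
by rewrite (dvdn_mull a) ?dvdn_gcdr // (dvdn_mulr b) ?dvdn_gcdr //
  (dvdn_mull m) ?dvdn_gcdr.
Qed.

Lemma gcdn_lcm_dvd a b m : gcdn (lcmn a b) m %| gcdn a m * gcdn b m.
Proof.
apply: dvdn_trans (gcdnM_dvd a b m).
by rewrite dvdn_gcd dvdn_gcdr (dvdn_trans (dvdn_gcdl _ _)) // -muln_lcm_gcd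
  dvdn_mulr.
Qed.

(** Divisors of N that are nearly coprime in pairs multiply to little more than
    their least common multiple, which divides N. *)
Lemma prod_le_of_small_gcds N B K (m : nat -> nat) : 0 < N -> 0 < B ->
    (forall e, e < K -> m e %| N) ->
    (forall e f, e < f -> f < K -> gcdn (m e) (m f) <= B) ->
  \prod_(e < K) m e <= N * B ^ (K * K).
Proof.
move=> N0 B0 mN mB; pose L k := \big[lcmn/1]_(e < k) m e.
have LS k : L k.+1 = lcmn (L k) (m k) by rewrite /L big_ord_recr.
have LN k : k <= K -> L k %| N.
  elim: k => [|k IH] lt_kK; first by rewrite /L big_ord0 dvd1n.
  by rewrite LS dvdn_lcm IH ?mN // ltnW.
have Lgcd k x : gcdn (L k) x %| \prod_(e < k) gcdn (m e) x.
  elim: k => [|k IH]; first by rewrite /L !big_ord0 gcd1n.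
  rewrite LS big_ord_recr /=; apply: dvdn_trans (gcdn_lcm_dvd _ _ _) _.
  exact: dvdn_mul.
suff H k : k <= K -> \prod_(e < k) m e <= L k * B ^ (k * k).
  apply: leq_trans (H K (leqnn K)) _.
  by rewrite leq_mul2r dvdn_leq ?orbT // LN.
elim: k => [|k IH] lt_kK; first by rewrite /L !big_ord0.
have mk0 : 0 < m k by apply: dvdn_gt0 (mN _ lt_kK).
have gcdB : gcdn (L k) (m k) <= B ^ k.
  apply: leq_trans (dvdn_leq _ (Lgcd k (m k))) _.
    by rewrite prodn_gt0 // => e; rewrite gcdn_gt0 mk0 orbT.
  rewrite -[X in B ^ X](card_ord k) -prod_nat_const.
  by apply: leq_prod => e _; apply: mB.
rewrite big_ord_recr /=.
apply: leq_trans (_ : L k * B ^ (k * k) * m k <= _).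
  by rewrite leq_mul2r IH ?orbT // ltnW.
rewrite mulnAC -(muln_lcm_gcd (L k)) -LS -mulnA leq_mul2l.
apply/orP; right; apply: leq_trans (_ : B ^ k * B ^ (k * k) <= _).
  by rewrite leq_mul2r gcdB orbT.
by rewrite -expnD leq_pexp2l //; nia.
Qed.

(** The quotients m of these gcds by the common gcd g all divide N.  A common
    divisor d of N, x + e y and x + f y divides (f - e) x and (f - e) y, hence
    (f - e) g; so the quotients for e and f have a gcd dividing f - e.  The
    smallest of the K quotients is at most the geometric mean. *)
Lemma exists_small_gcd_on_line N K x y : 0 < N -> 0 < K ->
  exists e m, [/\ e < K, gcdn N (x + e * y) = m * gcdn N (gcdn x y)
                & m ^ K <= N * K ^ (K * K)].
Proof.
move=> N0 K0; set g := gcdn N (gcdn x y).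
have g0 : 0 < g by rewrite gcdn_gt0 N0.
pose G e := gcdn N (x + e * y); pose m e := G e %/ g.
have gG e : g %| G e.
  rewrite dvdn_gcd dvdn_gcdl dvdn_add ?dvdn_mull //.
    exact: dvdn_trans (dvdn_gcdr _ _) (dvdn_gcdl _ _).
  exact: dvdn_trans (dvdn_gcdr _ _) (dvdn_gcdr _ _).
have Gm e : G e = m e * g by rewrite /m divnK.
have mN e : m e %| N.
  by apply: dvdn_trans (dvdn_gcdl N (x + e * y)); rewrite -/(G e) Gm dvdn_mulr.
have mK e f : e < f -> f < K -> gcdn (m e) (m f) <= K.
  move=> lt_ef lt_fK; apply: leq_trans (_ : f - e <= _); last by lia.
  apply: dvdn_leq; first by rewrite subn_gt0.
  rewrite -(dvdn_pmul2r g0) muln_gcdl -!Gm; set d := gcdn _ _.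
  have dN : d %| N by apply: dvdn_trans (dvdn_gcdl _ _) (dvdn_gcdl _ _).
  have de : d %| x + e * y by apply: dvdn_trans (dvdn_gcdl _ _) (dvdn_gcdr _ _).
  have df : d %| x + f * y by apply: dvdn_trans (dvdn_gcdr _ _) (dvdn_gcdr _ _).
  rewrite /g !muln_gcdr !dvdn_gcd dvdn_mull //=.
  (* Both (f - e) x and (f - e) y are combinations of x + e y and x + f y. *)
  have -> : (f - e) * y = (x + f * y) - (x + e * y) by rewrite mulnBl; lia.
  have -> : (f - e) * x = f * (x + e * y) - e * (x + f * y).
    by rewrite mulnBl !mulnDr !mulnA (mulnC f e); lia.
  by rewrite !dvdn_sub // dvdn_mull.
case: (@arg_minnP _ (Ordinal K0) xpredT (fun e => m e)) => // e _ min_e.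
exists e, (m e); split => //; first exact: Gm.
apply: leq_trans (prod_le_of_small_gcds _ _ _ _ N0 K0 (fun e _ => mN e) mK).
rewrite -[X in _ ^ X](card_ord K) -prod_nat_const.
by apply: leq_prod => f _; apply: min_e.
Qed.

(** Each new variable is added along a line through the combination already
    found, at the cost of one more factor m in J. *)
Lemma exists_small_gcd_combination N K r (x : nat -> nat) : 0 < N -> 0 < K ->
  exists (e : nat -> nat) J, [/\ forall i, e i < K, 0 < J,
    gcdn N (\sum_(i < r) e i * x i) %| J * gcdn N (\big[gcdn/0]_(i < r) x i)
    & J ^ K <= (N * K ^ (K * K)) ^ r].
Proof.
move=> N0 K0; elim: r => [|r [e [J [eK J0 dvdJ leJ]]]].
  by exists (fun=> 0), 1; split; rewrite ?big_ord0 ?mul1n ?exp1n.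
have [f [m [fK Gm lem]]] :=
  exists_small_gcd_on_line N K (\sum_(i < r) e i * x i) (x r) N0 K0.
exists (fun i => if i < r then e i else f), (m * J); split.
- by move=> i; case: ifP.
- rewrite muln_gt0 J0 andbT.
  have := gcdn_gt0 N (\sum_(i < r) e i * x i + f * x r).
  by rewrite N0 Gm muln_gt0 => /andP[].
- rewrite !big_ord_recr /= ltnn.
  under eq_bigr => i _ do rewrite ltn_ord.
  rewrite Gm -mulnA dvdn_mul // !gcdnA.
  set g := gcdn N (\big[gcdn/0]_(i < r) x i) in dvdJ *.
  apply: dvdn_trans (_ : gcdn (J * g) (x r) %| _).
    by rewrite dvdn_gcd dvdn_gcdr (dvdn_trans (dvdn_gcdl _ _) dvdJ).
  by rewrite muln_gcdr dvdn_gcd dvdn_gcdl dvdn_mull ?dvdn_gcdr.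
- by rewrite expnMn expnS leq_mul.
Qed.

(** * Orders modulo a prime through discrete logarithms *)

Lemma exists_primitive_root p : prime p -> exists w : {unit 'F_p},
  #[w]%g = p.-1 /\
  forall a, ~~ (p %| a) -> exists i, (a%:R : 'F_p)%R = val (w ^+ i)%g.
Proof.
move=> p_pr.
have /cyclicP [w Uw] := field_unit_group_cyclic [set: {unit 'F_p}]%G.
exists w; split; first by rewrite orderE -Uw card_finField_unit card_Fp.
move=> a pNa; have a_unit : (a%:R : 'F_p)%R \is a GRing.unit.
  by rewrite unitfE -(dvdn_pcharf (pchar_Fp p_pr)).
have: FinRing.unit 'F_p a_unit \in <[w]>%g by rewrite -Uw inE.
by case/cycleP => i wi; exists i; rewrite -wi.
Qed.

Lemma multorder_primitive_power p (w : {unit 'F_p}) a i :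
  #[w]%g = p.-1 -> (a%:R : 'F_p)%R = val (w ^+ i)%g ->
  multorder p a = p.-1 %/ gcdn p.-1 i.
Proof.
move=> ow ai; by rewrite /multorder -pmulrn ai valK orderXgcd ow.
Qed.

Lemma prod_primitive_powers p (w : {unit 'F_p}) r (b x e : 'I_r -> nat) :
    (forall i, ((b i)%:R : 'F_p)%R = val (w ^+ x i)%g) ->
  ((\prod_(i < r) b i ^ e i)%:R : 'F_p)%R
    = val (w ^+ (\sum_(i < r) e i * x i))%g.
Proof.
move=> bx.
apply: (big_rec2 (fun a s => (a%:R : 'F_p)%R = val (w ^+ s)%g)) => // i a s _ IH.
by rewrite natrM natrX bx IH expgD (mulnC (e i)) expgM FinRing.val_unitM
  !FinRing.val_unitX.
Qed.

Definition products_distinct_mod p r E (b : nat -> nat) :=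
  forall f g : {ffun 'I_r -> 'I_E.+1},
  \prod_(i < r) b i ^ f i = \prod_(i < r) b i ^ g i %[mod p] -> f = g.

(** The right-hand side is the order of the subgroup generated by the b_i.  The
    discrete logarithms of the products are multiples of the gcd modulo p - 1,
    so there are at most that many products modulo p. *)
Lemma distinct_products_le_order p (w : {unit 'F_p}) r E (b x : nat -> nat) :
    prime p -> #[w]%g = p.-1 ->
    (forall i, i < r -> ((b i)%:R : 'F_p)%R = val (w ^+ x i)%g) ->
    products_distinct_mod p r E b ->
  E.+1 ^ r <= p.-1 %/ gcdn p.-1 (\big[gcdn/0]_(i < r) x i).
Proof.
move=> p_pr ow bx distinct; set g := gcdn _ _.
have N0 : 0 < p.-1 by rewrite -subn1 subn_gt0 prime_gt1.
have g0 : 0 < g by rewrite gcdn_gt0 N0.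
have Ng : p.-1 = p.-1 %/ g * g by rewrite divnK // dvdn_gcdl.
pose s (f : {ffun 'I_r -> 'I_E.+1}) := \sum_(i < r) f i * x i.
have gs f : g %| s f.
  apply: dvdn_sum => i _; apply: dvdn_mull.
  by apply: dvdn_trans (dvdn_gcdr _ _) _; rewrite (bigD1 i) // dvdn_gcdl.
have s_lt f : s f %% p.-1 %/ g < p.-1 %/ g.
  by rewrite ltn_divLR // -Ng ltn_mod.
have inj : injective (fun f => Ordinal (s_lt f)).
  move=> f f' [eq_ff']; apply: distinct.
  have eq_s : s f = s f' %[mod p.-1].
    have gm h : g %| s h %% p.-1.
      by rewrite /dvdn modn_dvdm ?dvdn_gcdl // [_ == _]gs.
    by rewrite -(divnK (gm f)) eq_ff' divnK.
  have prodE (h : {ffun 'I_r -> 'I_E.+1}) :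
      ((\prod_(i < r) b i ^ h i)%:R : 'F_p)%R = val (w ^+ s h)%g.
    by apply: prod_primitive_powers => i; apply: bx.
  rewrite -!(val_Fp_nat p_pr) !prodE; congr (val (val _)).
  by rewrite -(expg_mod_order w (s f)) ow eq_s -ow expg_mod_order.
have := leq_card _ inj; rewrite card_ffun !card_ord; exact.
Qed.

(** J bounds the index of the subgroup generated by the product in the one
    generated by all the b_i. *)
Lemma exists_product_of_large_order p r E K (b : nat -> nat) :
    prime p -> 0 < K -> (forall i, i < r -> ~~ (p %| b i)) ->
    products_distinct_mod p r E b ->
  exists (e : nat -> nat) J, [/\ forall i, e i < K,
    J ^ K <= (p * K ^ (K * K)) ^ r
    & E.+1 ^ r <= J * multorder p (\prod_(i < r) b i ^ e i)%N].
Proof.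
move=> p_pr K0 pb distinct.
have N0 : 0 < p.-1 by rewrite -subn1 subn_gt0 prime_gt1.
have [w [ow logw]] := exists_primitive_root _ p_pr.
have /choice [x bx] : forall i, exists j,
    i < r -> ((b i)%:R : 'F_p)%R = val (w ^+ j)%g.
  move=> i; case: (boolP (i < r)) => [/pb/logw [j bj]|_]; last by exists 0.
  by exists j.
have [e [J [eK J0 dvdJ leJ]]] := exists_small_gcd_combination _ _ r x N0 K0.
have := distinct_products_le_order _ _ _ _ _ _ p_pr ow bx distinct.
set g := gcdn _ (\big[gcdn/0]_(i < r) _) in dvdJ * => le_g.
have g0 : 0 < g by rewrite gcdn_gt0 N0.
exists e, J; split => //.
  apply: leq_trans leJ _.
  have le_p : p.-1 * K ^ (K * K) <= p * K ^ (K * K).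
    by rewrite leq_mul2r leq_pred orbT.
  by case: (r) => [//|r0]; rewrite leq_exp2r.
rewrite (multorder_primitive_power _ _ _ _ ow
  (prod_primitive_powers _ _ _ _ _ _ (fun i => bx i (ltn_ord i)))).
set G := gcdn _ (\sum_(i < r) _) in dvdJ *.
apply: leq_trans le_g _; rewrite leq_divLR ?dvdn_gcdl //.
rewrite -{1}(divnK (dvdn_gcdl p.-1 (\sum_(i < r) e i * x i))) -/G mulnAC mulnC.
rewrite leq_mul2r.
by apply/orP; right; apply: dvdn_leq; rewrite // muln_gt0 J0.
Qed.

Lemma distinct_powers_le_order p E (b : nat -> nat) :
  prime p -> ~~ (p %| b 0) -> products_distinct_mod p 1 E b ->
  E < multorder p (b 0).
Proof.
move=> p_pr pb distinct.
have [w [ow logw]] := exists_primitive_root _ p_pr; have [j bj] := logw _ pb.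
rewrite (multorder_primitive_power _ _ _ _ ow bj).
have bx i : i < 1 -> ((b i)%:R : 'F_p)%R = val (w ^+ j)%g by case: i.
have := distinct_products_le_order p w 1 E b (fun=> j) p_pr ow bx distinct.
by rewrite expn1 big_ord1.
Qed.

(** * Primes modulo which two products of small prime powers collide *)

(** Some prime above m, not the least one: only distinctness of the primes
    matters. *)
Definition larger_prime m := s2val (prime_above m).

Definition prime_seq n := iter n.+1 larger_prime 0.

Lemma prime_seq_prime n : prime (prime_seq n).
Proof. by rewrite /prime_seq iterS /larger_prime; case: prime_above. Qed.

Lemma prime_seq_inj : injective prime_seq.
Proof.
have inc : {homo prime_seq : i j / i < j}.
  apply: homo_ltn => [y x z|n]; first exact: ltn_trans.
  by rewrite /prime_seq [X in _ < X]iterS {2}/larger_prime; case: prime_above.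
move=> i j eq_ij; case: (ltngtP i j) => // /inc; first by rewrite eq_ij ltnn.
by rewrite eq_ij ltnn.
Qed.

Lemma logn_prime_seq_prod r (a : 'I_r -> nat) (j : 'I_r) :
  logn (prime_seq j) (\prod_(i < r) prime_seq i ^ a i) = a j.
Proof.
rewrite (bigD1 j) //= mulnC logn_Gauss ?pfactorK ?prime_seq_prime //.
elim/big_rec: _ => [|i n neq_ij]; first by rewrite coprimen1.
rewrite coprimeMr => ->; rewrite andbT coprimeXr // prime_coprime ?prime_seq_prime //.
rewrite dvdn_prime2 ?prime_seq_prime //; apply: contra neq_ij => /eqP/prime_seq_inj.
by move/val_inj->.
Qed.

(** The value h i stands for the exponent h i - E, between - E and E: positive
    exponents contribute to u and negative ones to v, so that the truncated
    subtractions pick the right part.  Encoding the reduced fractions u / v,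
    and not the pairs of products, keeps the number of differences near E ^ r
    and not E ^ (2 r). *)
Definition prime_powers_dist r E (h : {ffun 'I_r -> 'I_(E.*2.+1)}) :=
  let u := \prod_(i < r) prime_seq i ^ (h i - E) in
  let v := \prod_(i < r) prime_seq i ^ (E - h i) in
  (u - v) + (v - u).

Definition collision_product r E :=
  \prod_(h : {ffun 'I_r -> 'I_(E.*2.+1)} | prime_powers_dist r E h != 0)
    prime_powers_dist r E h.

Lemma collision_product_gt0 r E : 0 < collision_product r E.
Proof. by apply: prodn_cond_gt0 => h; rewrite lt0n. Qed.

(** If two products agree modulo p, remove from both the product c of the powers
    with the smaller exponents: as p is prime to c, it divides u - v or v - u.
    That number is a factor of the collision product unless u = v, and then
    unique factorization gives equal exponents. *)
Lemma collision_free r E p : prime p ->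
    (forall i, i < r -> ~~ (p %| prime_seq i)) -> ~~ (p %| collision_product r E) ->
  products_distinct_mod p r E prime_seq.
Proof.
move=> p_pr pb pNW f g eq_fg.
have h_lt i : f i + (E - g i) < E.*2.+1.
  by have := ltn_ord (f i); have := ltn_ord (g i); lia.
pose h := [ffun i => Ordinal (h_lt i)].
pose c := \prod_(i < r) prime_seq i ^ minn (f i) (g i).
pose u := \prod_(i < r) prime_seq i ^ (f i - g i).
pose v := \prod_(i < r) prime_seq i ^ (g i - f i).
have fE : \prod_(i < r) prime_seq i ^ f i = c * u.
  by rewrite -big_split; apply: eq_bigr => i _ /=; rewrite -expnD; congr (_ ^ _); lia.
have gE : \prod_(i < r) prime_seq i ^ g i = c * v.
  by rewrite -big_split; apply: eq_bigr => i _ /=; rewrite -expnD; congr (_ ^ _); lia.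
have pc : coprime p c.
  rewrite coprime_sym /c; elim/big_rec: _ => [|i n _]; first exact: coprime1n.
  rewrite coprimeMl => ->; rewrite andbT coprimeXl // coprime_sym prime_coprime //.
  exact: pb.
have distE : prime_powers_dist r E h = (u - v) + (v - u).
  rewrite /prime_powers_dist.
  have -> : \prod_(i < r) prime_seq i ^ (h i - E) = u.
    apply: eq_bigr => i _; rewrite ffunE /=; congr (_ ^ _).
    by have := ltn_ord (f i); have := ltn_ord (g i); lia.
  have -> // : \prod_(i < r) prime_seq i ^ (E - h i) = v.
  apply: eq_bigr => i _; rewrite ffunE /=; congr (_ ^ _).
  by have := ltn_ord (f i); have := ltn_ord (g i); lia.
have uv : u = v.
  apply/eqP; case: (boolP (prime_powers_dist r E h == 0)); rewrite distE; first lia.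
  move=> nz; case/negP: pNW; rewrite /collision_product (bigD1 h) ?distE //=.
  rewrite dvdn_mulr //; move/eqP: eq_fg; rewrite fE gE.
  case: (leqP v u) => [le_vu|/ltnW le_uv].
    rewrite eqn_mod_dvd ?leq_mul2l ?le_vu ?orbT // -mulnBr Gauss_dvdr // => H.
    by rewrite dvdn_add // (eqP le_vu) dvdn0.
  rewrite eq_sym eqn_mod_dvd ?leq_mul2l ?le_uv ?orbT // -mulnBr Gauss_dvdr // => H.
  by rewrite dvdn_add // (eqP le_uv) dvdn0.
apply/ffunP => i; apply: val_inj => /=.
have := congr1 (logn (prime_seq i)) uv; rewrite /u /v !logn_prime_seq_prod.
lia.
Qed.

Lemma exp2_size_primes_le n : 0 < n -> 2 ^ size (primes n) <= n.
Proof.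
move=> n0; rewrite [X in _ <= X](prod_prime_decomp n0) /primes size_map.
have: forall f, f \in prime_decomp n -> 1 < f.1 ^ f.2.
  case=> q e /mem_prime_decomp[q_pr e0 _] /=.
  by rewrite -(exp1n e) ltn_exp2r // prime_gt1.
elim: (prime_decomp n) => [|f s IH] gt1; first by rewrite big_nil.
rewrite big_cons /= expnS leq_mul ?gt1 ?mem_head ?IH // => f' f's.
by rewrite gt1 // inE f's orbT.
Qed.

(** The collision product is at most M ^ (E (2 E + 1) ^ r), with M the product of
    the r primes; its number of prime factors is at most its binary logarithm,
    and M <= 2 ^ M. *)
Lemma size_primes_collision_product r E :
  size (primes (collision_product r E))
    <= (\prod_(i < r) prime_seq i) * (E.*2.+1) ^ r.+1.
Proof.
set M := \prod_(i < r) _.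
have M0 : 0 < M by apply: prodn_gt0 => i; rewrite prime_gt0 ?prime_seq_prime.
have le_pow (a : 'I_r -> nat) : (forall i, a i <= E) ->
    \prod_(i < r) prime_seq i ^ a i <= M ^ E.
  move=> aE; rewrite /M (big_morph (expn^~ E) (fun x y => expnMn x y E) (exp1n E)).
  by apply: leq_prod => i _; rewrite leq_exp2l ?prime_gt1 ?prime_seq_prime.
have leD h : prime_powers_dist r E h <= M ^ E.
  rewrite /prime_powers_dist; set u := \prod_(i < r) _; set v := \prod_(i < r) _.
  have: u <= M ^ E by apply: le_pow => i; have := ltn_ord (h i); lia.
  have: v <= M ^ E by apply: le_pow => i; lia.
  lia.
rewrite -(leq_exp2l (m := 2)) //.
apply: leq_trans (exp2_size_primes_le _ (collision_product_gt0 r E)) _.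
apply: leq_trans (_ : (M ^ E) ^ (E.*2.+1 ^ r) <= _).
  rewrite -[X in _ ^ (X ^ r)](card_ord E.*2.+1) -[X in _ ^ (_ ^ X)](card_ord r).
  rewrite -card_ffun -prod_nat_const /collision_product big_mkcond.
  by apply: leq_prod => h _; case: ifP => // _; rewrite expn_gt0 M0.
rewrite -expnM; apply: leq_trans (_ : (2 ^ M) ^ (E * E.*2.+1 ^ r) <= _).
  have [|n0] := posnP (E * E.*2.+1 ^ r); first by move->.
  by rewrite leq_exp2r // ltnW // ltn_expl.
by rewrite -expnM leq_exp2l // leq_mul2l expnS leq_mul2r; lia.
Qed.

(** A bad prime is at most B or divides the collision product. *)
Lemma count_primes_le B r E n (bad : pred nat) :
    (forall p, prime p -> p <= n -> B < p ->
      products_distinct_mod p r E prime_seq -> ~~ bad p) ->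
    (forall i, i < r -> prime_seq i <= B) ->
  count (fun p => prime p && bad p) (iota 0 n.+1)
    <= B.+1 + (\prod_(i < r) prime_seq i) * (E.*2.+1) ^ r.+1.
Proof.
move=> good leB.
apply: leq_trans _ (leq_add (leqnn _) (size_primes_collision_product r E)).
rewrite -size_filter -[B.+1](size_iota 0) -size_cat.
apply: uniq_leq_size; first by rewrite filter_uniq ?iota_uniq.
move=> p; rewrite mem_filter mem_cat !mem_iota !add0n !leq0n /= -andbA.
case/and3P=> p_pr bad_p; rewrite !ltnS => le_pn.
case: (leqP p B) => //= lt_Bp; rewrite mem_primes p_pr collision_product_gt0 /=.
apply: contraLR bad_p => pNW; apply: good => //; apply: collision_free => // i lt_ir.
rewrite dvdn_prime2 ?prime_seq_prime // neq_ltn; apply/orP; right.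
exact: leq_ltn_trans (leB i lt_ir) lt_Bp.
Qed.

Local Open Scope ring_scope.

(** * Statements that hold for almost all primes *)

(** ln x <= x ^ d / d for every d > 0.  With d half of 1 - eta, the product
    x ^ eta ln x is at most x ^ (1 - d) / d, which is o(x). *)
Lemma almost_all_primes_of_power_bound (R : realType) (P : nat -> Prop) (C eta : R) :
    0 < C -> eta < 1 ->
    (forall x, 1 <= x -> (exceptional_primes P x)%:R <= C * x `^ eta) ->
  almost_all_primes R P.
Proof.
move=> C0 eta1 bound; apply/eqoP => e e0.
pose d : R := (1 - eta) / 2.
have d0 : 0 < d by rewrite /d; lra.
have dN0 : d != 0 by rewrite gt_eqF.
(* From X on, x ^ d absorbs the constant C / (d e). *)
pose X : R := (C / (d * e)) `^ d^-1.
near=> x.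
have x2 : 2 <= x by near: x; apply: nbhs_pinfty_ge; rewrite num_real.
have xX : X <= x by near: x; apply: nbhs_pinfty_ge; rewrite num_real.
have x0 : 0 < x by lra.
have lnx0 : 0 < ln x by apply: ln_gt0; lra.
rewrite normr_nat gtr0_norm ?divr_gt0 //.
apply: le_trans (bound x _) _; first lra.
rewrite mulrA ler_pdivlMr //.
have xd0 : 0 < x `^ d by apply: powR_gt0.
have ln_le : ln x <= x `^ d / d.
  by rewrite ler_pdivlMr //; have := ln_sublinear xd0; rewrite ln_powR; lra.
have large : C / (d * e) <= x `^ d.
  rewrite -[leLHS]powRr1; last by apply/ltW/divr_gt0 => //; apply: mulr_gt0.
  rewrite -(mulVf dN0) powRrM.
  apply: ge0_ler_powR => //; first exact: ltW.
    by rewrite nnegrE powR_ge0.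
  by rewrite nnegrE ltW.
have xE : x = x `^ eta * x `^ d * x `^ d.
  rewrite -!powRD ?(gt_eqF x0) ?implybT // (_ : eta + d + d = 1); last by rewrite /d; lra.
  by rewrite powRr1 // ltW.
rewrite [in leRHS]xE.
have xeta0 : 0 < x `^ eta by apply: powR_gt0.
apply: le_trans (_ : C * x `^ eta * (x `^ d / d) <= _).
  by rewrite ler_wpM2l //; apply/ltW/mulr_gt0.
rewrite ler_pdivrMr ?(mulr_gt0 d0) // in large.
rewrite mulrA ler_pdivrMr //.
have : 0 <= (x `^ eta * x `^ d) * (x `^ d * (d * e) - C).
  by rewrite mulr_ge0 ?subr_ge0 //; apply/ltW/mulr_gt0.
lra.
Unshelve. all: by end_near.
Qed.

(** The exponent bound E is the integer part of x ^ theta, the same for all the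
    primes up to x; O(E ^ (r+1)) of them are lost. *)
Lemma almost_all_primes_of_distinct_products (R : realType) (r B : nat) (theta : R)
    (P : nat -> Prop) :
    0 < theta -> theta * r.+1%:R < 1 ->
    (forall i, (i < r)%N -> (prime_seq i <= B)%N) ->
    (forall p E, prime p -> (B < p)%N -> products_distinct_mod p r E prime_seq ->
      p%:R `^ theta < E.+1%:R -> P p) ->
  almost_all_primes R P.
Proof.
move=> theta0 theta1 leB PP.
set M := (\prod_(i < r) prime_seq i)%N.
apply: (almost_all_primes_of_power_bound R P (B.+1%:R + M%:R * 3 ^+ r.+1)
  (theta * r.+1%:R)) => //.
move=> x x1; have x0 : 0 <= x by lra.
have xt1 : 1 <= x `^ theta.
  by have := ler_powR x1 (ltW theta0); rewrite powRr0.
pose E := Num.truncn (x `^ theta).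
have leE : (E%:R : R) <= x `^ theta by rewrite truncn_le powR_ge0.
have count_le : (exceptional_primes P x <= B.+1 + M * E.*2.+1 ^ r.+1)%N.
  apply: count_primes_le leB => p p_pr le_px lt_Bp distinct.
  apply/negPn/asboolP; apply: PP distinct _ => //.
  apply: le_lt_trans (truncnS_gt (x `^ theta)).
  apply: ge0_ler_powR; rewrite ?nnegrE ?ler0n //; first exact: ltW.
  by apply: le_trans (_ : (Num.truncn x)%:R <= _); rewrite ?ler_nat ?truncn_le.
apply: le_trans (_ : (B.+1 + M * E.*2.+1 ^ r.+1)%N%:R <= _); first by rewrite ler_nat.
rewrite natrD natrM natrX mulrDl powRrM powR_mulrn ?powR_ge0 // -mulrA -exprMn.
apply: lerD; first by rewrite ler_peMr ?ler0n // exprn_ege1.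
rewrite ler_wpM2l ?ler0n //; apply: lerXn2r; rewrite ?nnegrE ?ler0n //; first lra.
by rewrite -natr1 -muln2 natrM; lra.
Qed.

(** * The family of products *)

(** The hypotheses on E, J and o give o > p ^ (r / (r + 2)) / p ^ (2 / r), and
    the exponent here is at least 1 - 4 / r >= 1 - eps. *)
Lemma order_lower_bound (R : realType) (eps : R) p r E J o :
    (0 < p)%N -> 4 <= eps * r%:R -> (0 < r)%N ->
    p%:R `^ (r%:R + 2)^-1 < (E.+1%:R : R) ->
    (J ^ r <= p ^ 2)%N -> (E.+1 ^ r <= J * o)%N ->
  (p%:R : R) `^ (1 - eps) < o%:R.
Proof.
move=> p0 r4 r0 ltE leJ le_o.
have pR0 : 0 < (p%:R : R) by rewrite ltr0n.
have rR0 : 0 < (r%:R : R) by rewrite ltr0n.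
have J_le : (J%:R : R) <= p%:R `^ (2 / r%:R).
  rewrite -(@ler_pXn2r _ r) ?nnegrE ?ler0n ?powR_ge0 //.
  by rewrite -[leRHS]powR_mulrn ?powR_ge0 // -powRrM divfK ?gt_eqF // powR_mulrn ?ler0n //
    -!natrX ler_nat.
have: p%:R `^ (r%:R / (r%:R + 2)) < (J * o)%N%:R :> R.
  apply: lt_le_trans (_ : (E.+1 ^ r)%N%:R <= _); last by rewrite ler_nat.
  rewrite mulrC powRrM powR_mulrn ?powR_ge0 // natrX.
  by rewrite ltr_pXn2r ?nnegrE ?powR_ge0 // ler0n.
rewrite natrM => lt_Jo.
have: (p%:R : R) `^ (r%:R / (r%:R + 2)) < p%:R `^ (2 / r%:R) * o%:R.
  by apply: lt_le_trans lt_Jo _; rewrite ler_wpM2r ?ler0n.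
rewrite [ltRHS]mulrC -ltr_pdivrMr ?powR_gt0 // -powRB ?(gt_eqF pR0) ?implybT //.
apply: le_lt_trans; apply: ler_powR; first by rewrite ler1n.
have -> : r%:R / (r%:R + 2) = 1 - 2 / (r%:R + 2) :> R by field; lra.
have : 2 / (r%:R + 2) <= 2 / r%:R :> R by rewrite ler_pM2l // lef_pV2 ?posrE; lra.
have : 4 / r%:R <= eps by rewrite ler_pdivrMr.
lra.
Qed.

(** As 1 / eps >= 2, 5 / eps is at most (1 / eps) ^ 4, so ln r <= 4 ln (1 / eps);
    the constant 40 is 2 * 5 * 4. *)
Lemma exponent_family_card_le (R : realType) (eps : R) r :
    0 < eps <= 1 / 2 -> 0 < (r%:R : R) <= 5 / eps ->
  (((r * r) ^ r)%N%:R : R) <= expR (40 * (1 / eps * ln (1 / eps))).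
Proof.
move=> /andP[e0 e1] /andP[r0 r5].
have y2 : 2 <= 1 / eps by rewrite ler_pdivlMr //; lra.
set y := 1 / eps in y2 *.
have r5y : r%:R <= 5 * y by rewrite /y mulrA mulr1.
have lny0 : 0 <= ln y by apply: ln_ge0; lra.
have lnr : ln (r%:R : R) <= 4 * ln y.
  rewrite mulr_natl -lnXn; last lra.
  rewrite ler_ln ?posrE ?exprn_gt0 //; last lra.
  apply: le_trans r5y _.
  have : 2 ^+ 3 <= y ^+ 3 by apply: lerXn2r; rewrite ?nnegrE //; lra.
  rewrite exprSr; nra.
rewrite -[leLHS]lnK ?posrE; last by rewrite natrX exprn_gt0 // natrM mulr_gt0.
rewrite ler_expR natrX natrM lnXn ?mulr_gt0 // lnM ?posrE // -[leLHS]mulr_natl.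
apply: le_trans (_ : r%:R * (8 * ln y) <= _); first by rewrite ler_pM2l //; lra.
apply: le_trans (_ : (5 * y) * (8 * ln y) <= _); last lra.
by rewrite ler_wpM2r // mulr_ge0.
Qed.

Local Open Scope fset_scope.

Theorem mainTheorem4 (R : realType) :
  exists2 C : R, 0 < C &
    forall eps : R, 0 < eps < 1 ->
    exists2 A : {fset int},
      (#|` A|)%:R <= expR (C * (1 / eps * ln (1 / eps))) &
      almost_all_primes R (fun p : nat =>
        exists2 a : int, a \in A &
          ~~ (p %| a)%Z /\ (p%:R : R) `^ (1 - eps) < (multorder p a)%:R).
Proof.
exists 40 => // eps /andP[eps0 eps1].
(* For eps > 1/2 the bound may be less than 2, so A must be a singleton. *)
have [eps_small|eps_large] := leP eps (1 / 2); last first.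
  exists [fset Posz (prime_seq 0)].
    have y1 : 1 <= 1 / eps by rewrite ler_pdivlMr //; lra.
    rewrite cardfs1 -[leLHS]expR0 ler_expR mulr_ge0 // mulr_ge0 ?ln_ge0 //.
    exact: le_trans ler01 y1.
  apply: (almost_all_primes_of_distinct_products R 1 (prime_seq 0) (1 - eps)).
  - lra.
  - lra.
  - by case.
  move=> p E p_pr lt_p distinct ltE.
  have pNb : ~~ (p %| prime_seq 0)%N.
    by rewrite dvdn_prime2 ?prime_seq_prime // neq_ltn lt_p orbT.
  exists (Posz (prime_seq 0)); first by rewrite in_fset1.
  split; first by rewrite dvdzE.
  apply: lt_le_trans ltE _; rewrite ler_nat.
  exact: distinct_powers_le_order.
(* K = r ^ 2 makes the index J = O(p ^ (r / K)) an O(p ^ (1 / r)). *)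
pose r := (Num.truncn (4 / eps)).+1; pose K := (r * r)%N.
have r4 : 4 <= eps * r%:R.
  by rewrite mulrC -ler_pdivrMr //; apply/ltW/truncnS_gt.
have r5 : r%:R <= 5 / eps.
  rewrite /r -natr1.
  have : (Num.truncn (4 / eps))%:R <= 4 / eps by rewrite truncn_le divr_ge0 // ltW.
  have : 1 <= 1 / eps by rewrite ler_pdivlMr //; lra.
  lra.
pose F (e : {ffun 'I_r -> 'I_K}) := Posz (\prod_(i < r) prime_seq i ^ e i).
exists [fset z in codom F].
  apply: le_trans (exponent_family_card_le R eps r _ _); last 2 first.
  - by rewrite eps0.
  - by rewrite ltr0n.
  rewrite ler_nat card_fseq; apply: leq_trans (size_undup _) _.
  by rewrite size_codom card_ffun !card_ord.
(* For p > B the constant K ^ (K * K) in the bound for J is less than p, and p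
   is none of the primes used. *)
pose B := (K ^ (K * K) + \max_(i < r) prime_seq i)%N.
apply: (almost_all_primes_of_distinct_products R r B (r%:R + 2)^-1).
- by rewrite invr_gt0; have := ler0n R r; lra.
- by rewrite mulrC ltr_pdivrMr -natr1; have := ler0n R r; lra.
- move=> i lt_ir; apply: leq_trans (leq_addl _ _).
  exact: (leq_bigmax (Ordinal lt_ir)).
move=> p E p_pr lt_Bp distinct ltE.
have pN i : (i < r)%N -> ~~ (p %| prime_seq i)%N.
  move=> lt_ir; rewrite dvdn_prime2 ?prime_seq_prime // neq_ltn; apply/orP; right.
  apply: leq_ltn_trans lt_Bp; apply: leq_trans (leq_addl _ _).
  exact: (leq_bigmax (Ordinal lt_ir)).
have K0 : (0 < K)%N by [].
have [e [J [eK leJ le_o]]] :=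
  exists_product_of_large_order p r E K prime_seq p_pr K0 pN distinct.
exists (Posz (\prod_(i < r) prime_seq i ^ e i)).
  rewrite inE /=; apply/codomP; exists [ffun i : 'I_r => Ordinal (eK i)].
  by congr Posz; apply: eq_bigr => i _; rewrite ffunE.
split.
  rewrite dvdzE /= -prime_coprime // coprime_sym.
  elim/big_rec: _ => [|i n _]; first exact: coprime1n.
  by rewrite coprimeMl => ->; rewrite andbT coprimeXl // coprime_sym prime_coprime ?pN.
apply: order_lower_bound le_o => //; first exact: prime_gt0.
rewrite -(@leq_exp2r _ _ r) // -expnM; apply: leq_trans leJ _.
rewrite leq_exp2r // leq_mul2l; apply/orP; right.
exact/ltnW/(leq_ltn_trans (leq_addr _ _) lt_Bp).
Qed.
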